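(* For all integers $n,p,m\ge0$ (and $k\ge1$) and every real $x$, the polynomials $H_{n,p}(m;x)$ defined below satisfy \[ H_{n+1,p}(m;x)=\frac{l\,(p+1)\,(p+a+m)^{k}}{(p+a+m+1)^{k}}\,H_{n,p+1}(m;x)-q\,(x+p)\,H_{n,p}(m;x), \] and $H_{0,p}(m;x)=\dfrac{l^{a}}{a^{k}}$.
   Context: Let $k\ge1$ be an integer, let $a,q,l_1,\dots,l_k$ be nonzero reals, $l=\prod_{i=1}^k l_i$, $L=(l_1,\dots,l_k)$; denominators $a+j$ ($j\ge0$ integer) are assumed nonzero and $l^{a+i}$ means $l^a l^i$. Let $s(n,i)$ be the signed Stirling numbers of the first kind ($\frac{1}{i!}(\ln(1+x))^i=\sum_{n\ge i}s(n,i)\frac{x^n}{n!}$) and $\left\{ {n \atop i} \right\}$ the Stirling numbers of the second kind. Define \[ \mathcal{B}_{n,m}^{(k)}(a,q,L)=\frac{(a+m)^k}{a^k}\sum_{i=0}^{n}\frac{i!\,(-q)^{n-i}\,l^{i+a}}{(a+m+i)^k}\left\{ {n \atop i} \right\}, \] \[ H_{n,p}(m)=\frac{1}{p!\,l^{p}}\Big(\frac{p+a+m}{a+m}\Big)^{k}\sum_{i=0}^{p}s(p,i)(-q)^{p-i}\mathcal{B}_{n+i,m}^{(k)}(a,q,L), \] and the polynomials \[ H_{n,p}(m;x)=\sum_{i=0}^{n}\binom{n}{i}(-q)^{n-i}H_{i,p}(m)\,x^{n-i}. \] *)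

(* Defs.v *)
From HB Require Import structures.
From mathcomp Require Export all_boot all_order all_algebra.
From mathcomp Require Export reals exp trigo.
From mathcomp Require Export complex.

Set Implicit Arguments.
Unset Strict Implicit.
Unset Printing Implicit Defensive.

Import Order.TTheory GRing.Theory Num.Theory.
Local Open Scope ring_scope.
Local Open Scope complex_scope.

(* ln(1+x) = \sum_(j >= 1) (-1)^(j-1) x^j / j, cut off after degree n. *)
Definition log1p_trunc (R : fieldType) (n : nat) : {poly R} :=
  \sum_(1 <= j < n.+1) ((-1) ^+ j.-1 / j%:R) *: 'X^j.

(* s(n,i) is n! times the coefficient of x^n in (ln(1+x))^i / i!; terms of
   degree > n in the series of ln(1+x) do not contribute to that coefficient. *)
Definition stirling1 (R : fieldType) (n i : nat) : R :=
  n`!%:R * ((i`!%:R)^-1 *: log1p_trunc R n ^+ i)`_n.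

(* Partitions of an n-element set into i nonempty blocks. *)
Definition stirling2 (n i : nat) : nat :=
  #|[set P : {set {set 'I_n}} | partition P [set: 'I_n] & #|P| == i]|.

Section Polynomials.
Variables (R : realType).

(* Principal value of b^a. As b may be negative and a need not be an integer,
   the value is complex; for b > 0 it is the usual real power, and for b < 0 it
   is |b|^a e^(i pi a). *)
Definition cpowR (b a : R) : R[i] :=
  if 0 <= b then (b `^ a)%:C
  else (`|b| `^ a)%:C * (cos (pi * a) +i* sin (pi * a)).

Variables (k : nat) (a q : R) (L : k.-tuple R).

Definition lprod : R := \prod_(i < k) tnth L i.

(* l^(i+a), read as l^i l^a. *)
Definition lpow (i : nat) : R[i] := (lprod ^+ i)%:C * cpowR lprod a.

Definition calB (n m : nat) : R[i] :=
  ((a + m%:R) ^+ k / a ^+ k)%:C *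
  \sum_(0 <= i < n.+1)
    (i`!%:R * (- q) ^+ (n - i) / (a + m%:R + i%:R) ^+ k)%:C * lpow i
    * (stirling2 n i)%:R.

Definition Hnum (n p m : nat) : R[i] :=
  ((p`!%:R * lprod ^+ p)^-1 * ((p%:R + a + m%:R) / (a + m%:R)) ^+ k)%:C *
  \sum_(0 <= i < p.+1)
    (stirling1 R p i * (- q) ^+ (p - i))%:C * calB (n + i) m.

Definition Hpoly (n p m : nat) (x : R) : R[i] :=
  \sum_(0 <= i < n.+1)
    ('C(n, i)%:R * (- q) ^+ (n - i))%:C * Hnum i p m * (x ^+ (n - i))%:C.

End Polynomials.

(* Main.v *)
Require Import Defs.
From mathcomp Require Import all_boot all_order all_algebra.
From mathcomp Require Import reals exp trigo complex.
From mathcomp Require Import ring.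

(** Write T(n,p) for the inner sum of H(n,p), so that H(n,p) is T(n,p) times an
    explicit constant. The recurrence s(p+1,i+1) = s(p,i) - p s(p,i+1) gives
    T(n,p+1) = T(n+1,p) + p q T(n,p), which is the claim at x = 0; Pascal's rule
    turns it into the claim for H(n,p;x), the binomial transform of H(n,p) with
    parameter -qx. The value at n = 0 is Stirling inversion: the numbers B(i,m)
    are a weighted Stirling transform of the second kind, which the sum against
    s(p,i) undoes. *)

Import Order.TTheory GRing.Theory Num.Theory.

(** * Stirling numbers of the second kind: from counting set partitions to the recurrence *)

Fixpoint stirling2_rec (n i : nat) : nat :=
  match n, i with
  | 0, 0 => 1
  | 0, _.+1 => 0
  | _.+1, 0 => 0
  | n'.+1, i'.+1 => stirling2_rec n' i' + i'.+1 * stirling2_rec n' i'.+1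
  end.

Lemma stirling2_rec_small n i : n < i -> stirling2_rec n i = 0.
Proof.
elim: n i => [|n IHn] [|i] //= lt_ni; rewrite !IHn ?muln0 //.
exact: leqW.
Qed.

Section AddPoint.
Variables (T : finType) (D : {set T}) (x : T).
Hypothesis xND : x \notin D.

(* Adjoin [x] to the block [u.2] of [u.1]; [u.2 = set0] makes [x] a new block. *)
Definition add_point (u : {set {set T}} * {set T}) : {set {set T}} :=
  (x |: u.2) |: (u.1 :\ u.2).

(** Inverse of [add_point]. Removing [set0] discards the emptied block when [x] was a singleton
    block; [B] is then [set0], the marker for a new block. *)
Definition remove_point (Q : {set {set T}}) : {set {set T}} * {set T} :=
  let B := pblock Q x :\ x in ((B |: (Q :\ pblock Q x)) :\ set0, B).

Definition pointed_partition (u : {set {set T}} * {set T}) : bool :=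
  partition u.1 D && (u.2 \in set0 |: u.1).

Lemma notin_block P B : partition P D -> B \in P -> x \notin B.
Proof.
by move=> parP BP; apply: contra xND; apply/subsetP/(partitionS parP BP).
Qed.

Lemma pointed_block_sub u : pointed_partition u -> u.2 \subset D.
Proof.
case: u => P B /= /andP[/= parP /setU1P[->|BP]]; first exact: sub0set.
exact: partitionS parP BP.
Qed.

(** The block [x |: B] is nonempty and disjoint from [D :\: B], which the other blocks partition. *)
Lemma add_point_partition u :
  pointed_partition u -> partition (add_point u) (x |: D).
Proof.
move=> pu; have sBD := pointed_block_sub _ pu.
case: u pu sBD => P B /= /andP[/= parP B0P] sBD.
have parPB : partition (P :\ B) (D :\: B).
  case/setU1P: B0P => [->|]; last exact: partitionD1.
  rewrite setD0; have /eqP := partition0 parP; rewrite eqbF_neg => P0.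
  by rewrite setDE (setIidPl _) // subsetC sub1set inE.
have -> : x |: D = (x |: B) :|: (D :\: B).
  rewrite -setUA; congr (_ |: _); apply/setP => y; rewrite !inE.
  by have := subsetP sBD y; case: (y \in B) => [->|].
apply: partitionU1 => //; first by apply/set0Pn; exists x; rewrite setU11.
rewrite -setI_eq0; apply/eqP/setP => y; rewrite !inE.
case: eqP => [->|_] /=; first by rewrite (negPf xND) andbF.
by case: (y \in B).
Qed.

Lemma card_add_point u : pointed_partition u ->
  #|add_point u| = (#|u.1| + (u.2 == set0))%N.
Proof.
case: u => P B /andP[/= parP B0P]; rewrite /add_point /= cardsU1 !inE.
have -> : (x |: B \in P) = false.
  by apply/negP => /(notin_block _ _ parP); rewrite setU11.
rewrite andbF /= (cardsD1 B P).
case/setU1P: B0P => [->|BP]; first by rewrite (partition0 parP) eqxx addnC.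
by rewrite BP (negPf (partition_neq0 parP BP)) addn0.
Qed.

Lemma add_pointK u : pointed_partition u -> remove_point (add_point u) = u.
Proof.
move=> pu; have parQ := add_point_partition _ pu.
have sBD := pointed_block_sub _ pu.
have xNB : x \notin u.2 by apply: contra xND; apply/subsetP.
rewrite /remove_point (def_pblock (partition_trivIset parQ) (setU11 _ _) (setU11 _ _)).
rewrite setU1K //.
case: u pu sBD xNB {parQ} => P B /andP[/= parP B0P] sBD xNB; congr pair.
rewrite /add_point /= setU1K; last first.
  by rewrite !inE negb_and; apply/orP; right; apply/negP => /(notin_block _ _ parP); rewrite setU11.
apply/setP => E; rewrite !inE; have := partition0 parP.
case/setU1P: B0P => [->|BP] P0.
  by case: eqVneq => [->|_] //=; rewrite P0.
case: eqVneq => [->|_] /=; first by rewrite P0.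
by case: eqVneq => [->|].
Qed.

Lemma remove_point_pointed Q :
  partition Q (x |: D) -> pointed_partition (remove_point Q).
Proof.
move=> parQ; have xQ : x \in cover Q by rewrite (cover_partition parQ) setU11.
have EQ := pblock_mem xQ; have xE : x \in pblock Q x by rewrite mem_pblock.
rewrite /pointed_partition /remove_point /=; move: (pblock Q x) EQ xE => E EQ xE.
have parQE := partitionD1 parQ EQ; have sE := partitionS parQ EQ.
apply/andP; split; last first.
  by rewrite !inE eqxx /=; case: eqP.
have eD : D = (E :\ x) :|: ((x |: D) :\: E).
  apply/setP => y; rewrite !inE; have := subsetP sE y; rewrite !inE.
  case: eqVneq => [->|_] /=; first by rewrite xE (negPf xND).
  by case: (y \in E) => [->|].
have N0 : set0 \notin Q :\ E by rewrite (partition0 parQE).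
(* If [x] was alone in its block, the remaining blocks already partition [D]; otherwise the shrunken
   block is put back beside them. *)
have [E0|En0] := eqVneq (E :\ x) set0.
  by rewrite E0 setU1K // eD E0 set0U.
rewrite [X in partition X]( _ : _ = (E :\ x) |: (Q :\ E)).
  rewrite [X in partition _ X]eD; apply: partitionU1 => //.
  rewrite -setI_eq0; apply/eqP/setP => y; rewrite !inE.
  by case: (y \in E); rewrite ?andbF.
apply/setP => F; rewrite !inE; case: eqVneq => // -> /=.
by rewrite (partition0 parQ) andbF orbF eq_sym (negPf En0).
Qed.

Lemma remove_pointK Q : partition Q (x |: D) -> add_point (remove_point Q) = Q.
Proof.
move=> parQ; have xQ : x \in cover Q by rewrite (cover_partition parQ) setU11.
have EQ := pblock_mem xQ; have xE : x \in pblock Q x by rewrite mem_pblock.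
have trQ := partition_trivIset parQ.
rewrite /add_point /remove_point /=.
have defE F : F \in Q -> x \in F -> pblock Q x = F by exact: def_pblock.
move: (pblock Q x) EQ xE defE => E EQ xE defE; rewrite setD1K //.
apply/setP => F; rewrite !inE.
have [->|FE] /= := eqVneq F E; first by rewrite EQ.
have [->|F0] /= := eqVneq F set0; first by rewrite andbF (partition0 parQ).
(* The shrunken block is not itself in [Q]: being nonempty, it would meet [E] and so equal it. *)
have [FEx|//] /= := eqVneq F (E :\ x).
apply/esym/negP => FQ.
have /set0Pn[y yF] := F0.
have yE : y \in E by move: yF; rewrite FEx inE => /andP[].
case/eqP: FE; rewrite -(def_pblock trQ FQ yF); exact: (def_pblock trQ EQ yE).
Qed.

(** [add_point] is a bijection from pointed partitions of [D] to partitions of [x |: D], so it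
    suffices to count pairs (partition, chosen block or [set0]). *)
Lemma card_partitions_add_point i :
  #|[set P | partition P (x |: D) & #|P| == i.+1]| =
  (#|[set P | partition P D & #|P| == i]|
    + i.+1 * #|[set P | partition P D & #|P| == i.+1]|)%N.
Proof.
pose U := [set u | pointed_partition u & #|u.1| + (u.2 == set0) == i.+1].
have -> : [set P | partition P (x |: D) & #|P| == i.+1] = add_point @: U.
  apply/setP => Q; rewrite inE; apply/andP/imsetP => [[parQ cQ]|[u]].
    have pQ := remove_point_pointed _ parQ.
    exists (remove_point Q); last by rewrite remove_pointK.
    by rewrite inE pQ -card_add_point // remove_pointK.
  by rewrite inE => /andP[pu cu] ->; rewrite add_point_partition // card_add_point.
rewrite card_in_imset; last first.
  move=> u v; rewrite !inE => /andP[pu _] /andP[pv _] eq_uv.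
  by rewrite -(add_pointK u) // eq_uv add_pointK.
(* Pairs in [V] open a new block and come from partitions into [i] blocks; the others choose one of
   the [i.+1] blocks of a partition. *)
pose V := [set u : {set {set T}} * {set T} | u.2 == set0].
rewrite -(cardsID V U); congr (_ + _)%N.
  have inj0 : injective (fun P : {set {set T}} => (P, set0 : {set T})) by move=> P P' [].
  rewrite -[RHS](card_imset _ inj0).
  apply: eq_card => -[P B]; rewrite !inE /=.
  apply/andP/imsetP => [[/andP[/andP[/= parP _] cP] /eqP B0]|[P' ]].
    by exists P; [rewrite inE parP; move: cP; rewrite B0 eqxx addn1 eqSS|rewrite B0].
  rewrite inE => /andP[parP cP] [-> ->]; rewrite /pointed_partition /= parP.
  by rewrite setU11 eqxx addn1 eqSS.
rewrite mulnC -sum_nat_const -sum1_card.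
rewrite (eq_bigr (fun P : {set {set T}} => \sum_(B in P) 1)%N); last first.
  by move=> P; rewrite inE sum1_card => /andP[_ /eqP].
rewrite pair_big_dep; apply: eq_bigl => -[P B]; rewrite !inE /pointed_partition /= !inE.
have [->|] /= := eqVneq B set0; last by rewrite addn0 andbAC.
by case parP: (partition P D); rewrite //= (partition0 parP) andbF.
Qed.

End AddPoint.

(** Strong induction on the size of [D], for arbitrary subsets, so that deleting a point stays
    within the same type. *)
Lemma card_partitionsE (T : finType) (D : {set T}) i :
  #|[set P | partition P D & #|P| == i]| = stirling2_rec #|D| i.
Proof.
have [n] := ubnP #|D|; elim: n D i => // n IHn D i; rewrite ltnS => leDn.
have [->|/set0Pn[x xD]] := eqVneq D set0.
  rewrite cards0; case: i => [|i] /=.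
    rewrite -(cards1 (set0 : {set {set T}})); apply: eq_card => P.
    by rewrite !inE partition_set0; case: eqP => // ->; rewrite cards0.
  apply: eq_card0 => P; rewrite !inE partition_set0.
  by case: eqP => // ->; rewrite cards0.
rewrite (cardsD1 x) xD; case: i => [|i] /=.
  apply: eq_card0 => P; rewrite !inE cards_eq0; apply/negP => /andP[parP /eqP P0].
  by have := cover_partition parP; rewrite P0 /cover big_set0 => D0; move: xD; rewrite -D0 inE.
have ltD : #|D :\ x| < n by move: leDn; rewrite (cardsD1 x) xD.
by rewrite -[in LHS](setD1K xD) card_partitions_add_point ?setD11 // !IHn.
Qed.

Lemma stirling2E n i : stirling2 n i = stirling2_rec n i.
Proof. by rewrite /stirling2 card_partitionsE cardsT card_ord. Qed.

Local Open Scope ring_scope.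
Local Open Scope complex_scope.

(** * Stirling numbers of the first kind: recurrence from the truncated logarithm *)

Section Stirling1.
Variable R : numFieldType.

Lemma log1p_truncS n : log1p_trunc R n.+1 =
  log1p_trunc R n + ((-1) ^+ n / n.+1%:R) *: 'X^(n.+1).
Proof. by rewrite /log1p_trunc big_nat_recr. Qed.

Lemma log1p_trunc0 : log1p_trunc R 0 = 0.
Proof. by rewrite /log1p_trunc big_geq. Qed.

(** Truncated form of (1 + X) L' = 1: the derivative is a geometric sum in -X, which telescopes and
    leaves an error of degree n. *)
Lemma deriv_log1p_trunc n :
  ('X + 1) * (log1p_trunc R n)^`() = 1 - (- 'X) ^+ n.
Proof.
elim: n => [|n IHn]; first by rewrite log1p_trunc0 deriv0 mulr0 expr0 subrr.
rewrite log1p_truncS derivD mulrDr IHn derivZ derivXn -scaler_nat scalerA.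
rewrite divfK ?pnatr_eq0 //= -mul_polyC polyC_exp polyCN mulrA.
rewrite -mulrA -exprMn mulN1r exprS; ring.
Qed.

Lemma log1p_trunc_factor n : exists r, log1p_trunc R n = r * 'X.
Proof.
elim: n => [|n [r IHn]]; first by exists 0; rewrite log1p_trunc0 mul0r.
exists (r + ((-1) ^+ n / n.+1%:R) *: 'X^n).
by rewrite log1p_truncS IHn mulrDl -scalerAl -exprSr.
Qed.

(** The difference of the two powers is divisible by the difference of the bases, a multiple of
    X^(n+1). *)
Lemma coef_log1p_truncS n i :
  (log1p_trunc R n.+1 ^+ i)`_n = (log1p_trunc R n ^+ i)`_n.
Proof.
apply/eqP; rewrite -subr_eq0 -coefB subrXX log1p_truncS addrC addKr.
by rewrite -scalerAl coefZ coefXnM ltnSn mulr0.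
Qed.

Lemma stirling1_00 : stirling1 R 0 0 = 1.
Proof. by rewrite /stirling1 expr0 coefZ coefC eqxx !fact0 invr1 !mulr1. Qed.

Lemma stirling1_S0 n : stirling1 R n.+1 0 = 0.
Proof. by rewrite /stirling1 expr0 coefZ coefC !mulr0. Qed.

Lemma stirling1_small n i : (n < i)%N -> stirling1 R n i = 0.
Proof.
move=> lt_ni; have [r Dr] := log1p_trunc_factor n.
by rewrite /stirling1 Dr exprMn coefZ coefMXn lt_ni !mulr0.
Qed.

(* Coefficient of X^n in (1 + X) (L^(i+1))' = (i+1) L^i (1 - (-X)^(n+1)), for L
   the series of ln(1+X) truncated after degree n+1. *)
Lemma stirling1_SS n i :
  stirling1 R n.+1 i.+1 = stirling1 R n i - n%:R * stirling1 R n i.+1.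
Proof.
pose A := log1p_trunc R n.+1.
have /(congr1 (fun p : {poly R} => p`_n)) :
    ('X + 1) * (A ^+ i.+1)^`() = (1 - (- 'X) ^+ n.+1) * A ^+ i *+ i.+1.
  by rewrite deriv_exp -deriv_log1p_trunc -mulrA mulrnAr.
have -> : (('X + 1) * (A ^+ i.+1)^`())`_n =
    (A ^+ i.+1)`_n *+ n + (A ^+ i.+1)`_n.+1 *+ n.+1.
  rewrite mulrDl mul1r coefD coefXM !coef_deriv.
  by case: n @A => [|n] A //=; rewrite mulr0n.
have -> : ((1 - (- 'X) ^+ n.+1) * A ^+ i *+ i.+1)`_n = (A ^+ i)`_n *+ i.+1.
  rewrite coefMn mulrBl mul1r coefB exprNn -mulrA -polyCN -polyC_exp.
  by rewrite coefCM coefXnM ltnSn mulr0 subr0.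
(* All three Stirling numbers are now read off powers of the same truncation [A]. *)
rewrite /stirling1 !coefZ -(coef_log1p_truncS n i) -(coef_log1p_truncS n i.+1) -/A.
rewrite !factS !natrM -[_`_n *+ n]mulr_natl -[_`_n.+1 *+ _]mulr_natl -[RHS]mulr_natl => E.
have nz j : (j`!%:R : R) != 0 by rewrite pnatr_eq0 -lt0n fact_gt0.
have nS j : (1 + j%:R : R) != 0 by rewrite nat1r pnatr_eq0.
have -> : (A ^+ i)`_n = (n%:R * (A ^+ i.+1)`_n + n.+1%:R * (A ^+ i.+1)`_n.+1) / i.+1%:R.
  by rewrite E mulrC mulKf ?pnatr_eq0.
by field; rewrite nz nS.
Qed.

End Stirling1.

Lemma big_nat_widen0 (V : nmodType) (F : nat -> V) m n : (m <= n)%N ->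
  (forall i, (m <= i)%N -> F i = 0) ->
  \sum_(0 <= i < m) F i = \sum_(0 <= i < n) F i.
Proof.
move=> le_mn F0; rewrite (big_cat_nat (n := m) (p := n)) //=.
by rewrite [X in _ + X]big_nat [X in _ + X]big1 ?addr0 // => i /andP[/F0].
Qed.

(** * Weighted Stirling sums, their inversion, and binomial transforms *)

Section StirlingSums.
Variables (R : numFieldType) (V : comNzRingType) (f : {rmorphism R -> V}).

(** Used with [w] equal to -q for the recurrence of T(n,p), and with [w] equal to 1 for
    orthogonality. *)
Lemma stirling1_sumS (w : R) (u : nat -> V) p :
  \sum_(0 <= i < p.+2) f (stirling1 R p.+1 i * w ^+ (p.+1 - i)) * u i =
  \sum_(0 <= i < p.+1) f (stirling1 R p i * w ^+ (p - i)) * u i.+1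
  - f (p%:R * w) * \sum_(0 <= i < p.+1) f (stirling1 R p i * w ^+ (p - i)) * u i.
Proof.
rewrite big_nat_recl // stirling1_S0 mul0r rmorph0 mul0r add0r.
under eq_bigr => i _ do rewrite stirling1_SS subSS mulrBl rmorphB mulrBl.
rewrite sumrB; congr (_ - _).
rewrite [in RHS](big_nat_widen0 _ _ _ p.+2) //; last first.
  by move=> i lt_pi; rewrite stirling1_small // mul0r rmorph0 mul0r.
rewrite [in RHS]big_nat_recl // mulrDr.
(* Either p = 0 kills the first factor, or p > 0 and s(p,0) = 0. *)
have -> : f (p%:R * w) * (f (stirling1 R p 0 * w ^+ (p - 0)) * u 0) = 0.
  by case: p => [|p]; rewrite ?stirling1_S0 ?mul0r ?rmorph0 ?mul0r ?mulr0.
rewrite add0r mulr_sumr !big_nat; apply: eq_bigr => i /andP[_ le_ip].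
rewrite mulrA -rmorphM; congr (f _ * _).
(* At i = p the exponent [p - i.+1] is cut off at 0, but s(p,p+1) = 0 makes both sides vanish. *)
have [lt_ip|ge_ip] := ltnP i p; last first.
  by rewrite (@stirling1_small _ p i.+1) // mulr0 !mul0r mulr0.
by rewrite -[in LHS](subnSK lt_ip) exprS; ring.
Qed.

(** Induction on [p]: the two Stirling recurrences reduce the entry (p+1,j+1) to [p=j] +
    (j+1)[p=j+1] - p[p=j+1], where the last two terms cancel. *)
Lemma stirling_orthogonality p j :
  \sum_(0 <= i < p.+1) f (stirling1 R p i) * (stirling2_rec i j)%:R = (p == j)%:R.
Proof.
have recl q (v : nat -> V) : \sum_(0 <= i < q.+2) f (stirling1 R q.+1 i) * v i =
    \sum_(0 <= i < q.+1) f (stirling1 R q i) * v i.+1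
    - q%:R * \sum_(0 <= i < q.+1) f (stirling1 R q i) * v i.
  have := stirling1_sumS 1 v q; rewrite mulr1 rmorph_nat.
  under eq_bigr do rewrite expr1n mulr1.
  under [X in _ = X - _ -> _]eq_bigr do rewrite expr1n mulr1.
  by under [X in _ = _ - _ * X -> _]eq_bigr do rewrite expr1n mulr1.
elim: p j => [|p IHp] j.
  by rewrite big_nat1 stirling1_00 rmorph1 mul1r; case: j.
rewrite recl IHp; case: j => [|j] /=.
  rewrite big1 ?sub0r; last by move=> i _; rewrite mulr0.
  by case: p {IHp} => [|p]; rewrite ?mul0r ?mulr0 oppr0.
under eq_bigr do rewrite natrD natrM mulrDr mulrCA.
rewrite big_split /= IHp -mulr_sumr IHp eqSS.
by have [->|] := eqVneq p j.+1; rewrite ?mulr1 ?mulr0 ?addrK ?addr0 ?subr0.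
Qed.

(** The powers of [w] combine to w^(p-j), free of [i], so after exchanging the sums orthogonality
    applies to the sum over [i]. *)
Lemma stirling_inversion (w : R) (u : nat -> V) p :
  \sum_(0 <= i < p.+1) f (stirling1 R p i * w ^+ (p - i)) *
    (\sum_(0 <= j < i.+1) (stirling2_rec i j)%:R * f (w ^+ (i - j)) * u j) = u p.
Proof.
transitivity (\sum_(0 <= j < p.+1) f (w ^+ (p - j)) * u j * (p == j)%:R); last first.
  rewrite big_nat_recr //= big_nat big1 => [|j /andP[_ lt_jp]].
    by rewrite subnn eqxx rmorph1 mulr1 mul1r add0r.
  by rewrite gtn_eqF // mulr0.
transitivity (\sum_(0 <= i < p.+1) \sum_(0 <= j < p.+1)
    f (w ^+ (p - j)) * u j * (f (stirling1 R p i) * (stirling2_rec i j)%:R)).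
  rewrite !big_nat; apply: eq_bigr => i /andP[_ le_ip].
  (* Extending the inner range to j <= p adds only zeros S(i,j) with j > i, and makes the index set
     a square. *)
  rewrite mulr_sumr -(big_nat_widen0 _ _ _ _ le_ip); last first.
    by move=> j lt_ij; rewrite stirling2_rec_small // !mulr0.
  rewrite !big_nat; apply: eq_bigr => j /andP[_ le_ji].
  have -> : (p - j = (p - i) + (i - j))%N by rewrite addnBA // subnK.
  by rewrite exprD !rmorphM; ring.
rewrite exchange_big_nat /=; apply: eq_bigr => j _.
by rewrite -mulr_sumr stirling_orthogonality.
Qed.

(** Pascal's rule: one term shifts [u], the other releases a factor [w]. *)
Lemma binomial_transformS (w : R) (u : nat -> V) n :
  \sum_(0 <= i < n.+2) f ('C(n.+1, i)%:R * w ^+ (n.+1 - i)) * u i =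
  \sum_(0 <= i < n.+1) f ('C(n, i)%:R * w ^+ (n - i)) * u i.+1
  + f w * \sum_(0 <= i < n.+1) f ('C(n, i)%:R * w ^+ (n - i)) * u i.
Proof.
rewrite [LHS]big_nat_recl // bin0 subn0.
under eq_bigr => i _ do rewrite binS natrD subSS mulrDl rmorphD mulrDl.
rewrite big_split /= addrA addrC; congr (_ + _).
rewrite [in RHS](big_nat_widen0 _ _ _ n.+2) //; last first.
  by move=> i lt_ni; rewrite bin_small // mul0r rmorph0 mul0r.
rewrite [in RHS]big_nat_recl // bin0 subn0 mulrDr !mul1r mulrA -rmorphM -exprS.
congr (_ + _); rewrite mulr_sumr !big_nat; apply: eq_bigr => i /andP[_ le_in].
rewrite mulrA -rmorphM; congr (f _ * _).
have [lt_in|ge_in] := ltnP i n; last by rewrite bin_small // !mul0r mulr0.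
by rewrite -[in LHS](subnSK lt_in) exprS mulrCA.
Qed.

End StirlingSums.

(** * The recurrence at x = 0 and the value at n = 0 *)

Section Recurrence.
Variables (R : realType) (k : nat) (a q : R) (L : k.-tuple R) (m : nat).
Hypothesis l_neq0 : lprod L != 0.
Hypothesis aj_neq0 : forall j : nat, a + j%:R != 0.

Lemma addn_neq0 r : r%:R + a + m%:R != 0.
Proof. by rewrite [_ + a]addrC -addrA -natrD aj_neq0. Qed.

Lemma Hnum_rec n p : Hnum a q L n.+1 p m =
  (lprod L * (p%:R + 1) * (p%:R + a + m%:R) ^+ k / (p%:R + a + m%:R + 1) ^+ k)%:C
    * Hnum a q L n p.+1 m - (q * p%:R)%:C * Hnum a q L n p m.
Proof.
rewrite /Hnum (stirling1_sumS _ _ (real_complex R)).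
under [X in _ = _ * (_ * (X - _)) - _]eq_bigr do rewrite addnS -addSn.
have am_neq0 : a + m%:R != 0 by exact: aj_neq0.
have fact_neq0 : (p`!%:R : R) != 0 by rewrite pnatr_eq0 -lt0n fact_gt0.
have lp_neq0 : lprod L ^+ p != 0 by rewrite expf_neq0.
have pS_neq0 : (p.+1%:R : R) != 0 by rewrite pnatr_eq0.
rewrite mulrA -rmorphM.
(* The coefficient in the claim is exactly the ratio of the constants in front of T(n,p) and
   T(n,p+1). *)
have -> : lprod L * (p%:R + 1) * (p%:R + a + m%:R) ^+ k
      / (p%:R + a + m%:R + 1) ^+ k
      * ((p.+1`!%:R * lprod L ^+ p.+1)^-1
         * ((p.+1%:R + a + m%:R) / (a + m%:R)) ^+ k)
    = (p`!%:R * lprod L ^+ p)^-1 * ((p%:R + a + m%:R) / (a + m%:R)) ^+ k.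
  have -> : p%:R + a + m%:R + 1 = p.+1%:R + a + m%:R by rewrite -natr1; ring.
  rewrite natr1 factS natrM exprS !exprMn !exprVn.
  move: (expf_neq0 k (addn_neq0 p.+1)) (expf_neq0 k am_neq0).
  (* The k-th powers in denominators become nonzero variables for [field]. *)
  move: (_ ^+ k) ((a + m%:R) ^+ k) => B A B_neq0 A_neq0.
  by field; rewrite A_neq0 lp_neq0 fact_neq0 l_neq0 nat1r pS_neq0 B_neq0.
have cancel_S0 (c S1 S0 : R[i]) :
    c * S1 = c * (S1 - (p%:R * - q)%:C * S0) - (q * p%:R)%:C * (c * S0).
  rewrite mulrN rmorphN mulNr opprK [p%:R * q]mulrC; ring.
exact: cancel_S0.
Qed.

Lemma Hnum0 p : Hnum a q L 0 p m = cpowR (lprod L) a / (a ^+ k)%:C.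
Proof.
(* [u] gathers all of [calB] except S(i,j) and the power of -q; inversion leaves [u p], which the
   constant in [Hnum] reduces to l^a / a^k. *)
pose u j := ((a + m%:R) ^+ k / a ^+ k * (j`!%:R / (a + m%:R + j%:R) ^+ k))%:C
  * lpow a L j.
have calBE i : calB a q L (0 + i) m =
    \sum_(0 <= j < i.+1) (stirling2_rec i j)%:R * ((- q) ^+ (i - j))%:C * u j.
  rewrite add0n /calB mulr_sumr; apply: eq_bigr => j _.
  by rewrite stirling2E /u !rmorphM; ring.
rewrite /Hnum; under eq_bigr do rewrite calBE.
rewrite (stirling_inversion _ _ (real_complex R)) /u /lpow.
rewrite !mulrA -!rmorphM mulrC -fmorphV; congr (_ * _%:C).
have a_neq0 : a != 0 by have := aj_neq0 0; rewrite addr0.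
have am_neq0 : a + m%:R != 0 by exact: aj_neq0.
have fact_neq0 : (p`!%:R : R) != 0 by rewrite pnatr_eq0 -lt0n fact_gt0.
have lp_neq0 : lprod L ^+ p != 0 by rewrite expf_neq0.
have -> : a + m%:R + p%:R = p%:R + a + m%:R by ring.
rewrite exprMn exprVn.
by field; rewrite !expf_neq0 ?addn_neq0 // fact_neq0.
Qed.

Lemma HpolyE n p x : Hpoly a q L n p m x =
  \sum_(0 <= i < n.+1)
    ('C(n, i)%:R * (- (q * x)) ^+ (n - i))%:C * Hnum a q L i p m.
Proof.
apply: eq_bigr => i _; rewrite mulrAC -rmorphM; congr (_%:C * _).
by rewrite -mulNr exprMn mulrA.
Qed.

End Recurrence.

Theorem theorem22 (R : realType) (k : nat) (hk : (1 <= k)%N)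
    (a q : R) (L : k.-tuple R)
    (ha : a != 0) (hq : q != 0) (hL : forall i : 'I_k, tnth L i != 0)
    (haj : forall j : nat, a + j%:R != 0)
    (n p m : nat) (x : R) :
  Hpoly a q L n.+1 p m x =
    (lprod L * (p%:R + 1) * (p%:R + a + m%:R) ^+ k
       / (p%:R + a + m%:R + 1) ^+ k)%:C * Hpoly a q L n p.+1 m x
    - (q * (x + p%:R))%:C * Hpoly a q L n p m x
  /\ Hpoly a q L 0 p m x = cpowR (lprod L) a / (a ^+ k)%:C.
Proof.
have l_neq0 : lprod L != 0 by apply/prodf_neq0 => i _; exact: hL.
split; last first.
  by rewrite HpolyE big_nat1 bin0 subnn expr0 mulr1 mul1r Hnum0.
(* The transform contributes -qx and [Hnum_rec] contributes -qp; together they give the factor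
   -q(x+p). *)
rewrite !HpolyE (binomial_transformS _ _ (real_complex R)).
under [X in X + _ = _]eq_bigr do rewrite Hnum_rec // mulrBr mulrCA [X in _ - X]mulrCA.
rewrite sumrB -!mulr_sumr.
have collect_S0 (c S1 S0 : R[i]) :
    c * S1 - (q * p%:R)%:C * S0 + (- (q * x))%:C * S0
    = c * S1 - (q * (x + p%:R))%:C * S0.
  by rewrite [q * (x + _)]mulrDr rmorphN rmorphD; ring.
exact: collect_S0.
Qed.
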